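(* Let $A, B$ be closed linear operators in a complex Hilbert space $\mathbb{H}$, let $n$ be a non-negative integer, and let $\epsilon> 0$. Then the following hold. (1) $\Lambda_{n+1,\epsilon}(A,B) \subseteq \Lambda_{n,\epsilon}(A,B)$. (2) $\Lambda_{n,\epsilon_1}(A,B) \subseteq \Lambda_{n,\epsilon_2}(A,B)$ for every $0< \epsilon_1\leq \epsilon_2$. (3) $\sigma(A,B)= \bigcap_{\epsilon >0}\Lambda_{n,\epsilon}(A,B)$. (4) If $B\in\mathcal{B}(\mathbb{H})$ and $\delta>0$, then $\Lambda_{n,\epsilon}(A,B)+ \Delta_\delta \subseteq \Lambda_\epsilon(A,B)+\Delta_\delta\subseteq \Lambda_{\epsilon+\delta\|B\|}(A,B)$. (5) $\Lambda_{n,\epsilon} ( \alpha A,\alpha B)= \Lambda_{n,\frac{\epsilon}{|\alpha|}} (A,B)$ for every $\alpha\in\mathbb{C}$, $\alpha \neq 0$. (6) $\Lambda_{n,\epsilon}(\beta A+\alpha B, B)= \alpha+ \beta \, \Lambda_{n,\frac{\epsilon}{|\beta|}}(A,B)$ for every $\alpha, \beta \in \mathbb{C}$ with $\beta\neq 0$.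
   Context: $\mathbb{H}$ is a complex Hilbert space; $\mathcal{B}(\mathbb{H})$ is the set of bounded linear operators on $\mathbb{H}$. For (possibly unbounded) operators $A,B$ in $\mathbb{H}$ and $\lambda\in\mathbb{C}$, the pencil $\lambda B-A$ is defined on $D(A)\cap D(B)$. The generalized resolvent set is $\rho(A,B)=\{\lambda\in\mathbb{C}: (\lambda B-A)^{-1}\in\mathcal{B}(\mathbb{H})\}$ and $\sigma(A,B)=\mathbb{C}\setminus\rho(A,B)$. For a non-negative integer $n$ and $\epsilon>0$, the $(n,\epsilon)$-pseudospectrum is $$\Lambda_{n,\epsilon}(A,B)=\sigma(A,B)\cup\left\{\lambda\in\mathbb{C}: \left\|(\lambda B-A)^{-2^n}\right\|^{1/2^n}\ge \epsilon^{-1}\right\},$$ and $\Lambda_\epsilon(A,B)=\Lambda_{0,\epsilon}(A,B)$. For $r>0$, $\Delta_r=\{\lambda\in\mathbb{C}:|\lambda|\le r\}$. Sums of subsets of $\mathbb{C}$ are Minkowski sums, and $\alpha+\beta\Omega=\{\alpha+\beta z: z\in\Omega\}$. *)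

(* Defs.v *)
From HB Require Import structures.
From mathcomp Require Import all_boot all_order all_algebra.
From mathcomp Require Import complex.
From mathcomp Require Import all_classical all_reals all_analysis.

Set Implicit Arguments.
Unset Strict Implicit.
Unset Printing Implicit Defensive.
Import Order.TTheory GRing.Theory Num.Theory.
Import numFieldNormedType.Exports.

Local Open Scope classical_set_scope.
Local Open Scope ring_scope.
Local Open Scope complex_scope.

HB.mixin Record CompleteNormedModule_isHilbert (R : realType) H
    of CompleteNormedModule R[i] H := {
  inner : {dot H for @Num.conj R[i]} ;
  inner_norm : forall x : H, inner x x = `|x| ^+ 2
}.

#[short(type="hilbertType")]
HB.structure Definition Hilbert (R : realType) :=
  { H of CompleteNormedModule R[i] H & CompleteNormedModule_isHilbert R H }.

(* Norms over R[i] take values in R[i]; rnorm is the same norm, as an element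
   of R. *)
Definition rnorm (R : realType) (V : normedZmodType R[i]) (x : V) : R :=
  complex.Re `|x|.

(* A possibly unbounded linear operator in H, with domain dom; the values of
   the underlying function outside dom are irrelevant. *)
Record linop (R : realType) (H : hilbertType R) := LinOp {
  dom : set H ;
  op_fun :> H -> H ;
  dom0 : dom 0 ;
  dom_linear : forall (a : R[i]) x y, dom x -> dom y -> dom (a *: x + y) ;
  op_linear : forall (a : R[i]) x y, dom x -> dom y ->
    op_fun (a *: x + y) = a *: op_fun x + op_fun y
}.

Definition closed_op (R : realType) (H : hilbertType R) (A : linop H) : Prop :=
  closed [set p : H * H | dom A p.1 /\ p.2 = A p.1].

Section operations.
Context {R : realType} {H : hilbertType R}.
Implicit Types (A B : linop H) (a : R[i]).

Fact add_dom0 A B : (dom A `&` dom B) 0.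
Proof. by split; exact: dom0. Qed.

Fact add_dom_linear A B a x y : (dom A `&` dom B) x -> (dom A `&` dom B) y ->
  (dom A `&` dom B) (a *: x + y).
Proof. by move=> [? ?] [? ?]; split; exact: dom_linear. Qed.

Fact add_op_linear A B a x y : (dom A `&` dom B) x -> (dom A `&` dom B) y ->
  A (a *: x + y) + B (a *: x + y) = a *: (A x + B x) + (A y + B y).
Proof.
by move=> [? ?] [? ?]; rewrite !op_linear// scalerDr addrACA.
Qed.

Definition add_op A B : linop H :=
  LinOp (op_fun := fun x => A x + B x) (add_dom0 A B)
    (@add_dom_linear A B) (@add_op_linear A B).

Fact scale_op_linear b A a x y : dom A x -> dom A y ->
  b *: A (a *: x + y) = a *: (b *: A x) + b *: A y.
Proof.
by move=> ? ?; rewrite op_linear// scalerDr !scalerA [b * a]mulrC.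
Qed.

Definition scale_op a A : linop H :=
  LinOp (op_fun := fun x => a *: A x) (dom0 A) (@dom_linear _ _ A)
    (@scale_op_linear a A).

Definition pencil (l : R[i]) A B : linop H :=
  add_op (scale_op l B) (scale_op (- 1) A).

Definition is_BH (f : H -> H) : Prop :=
  linear f /\ exists M : R, forall x, rnorm (f x) <= M * rnorm x.

Definition opnorm (f : H -> H) : R :=
  sup [set rnorm (f x) | x in [set x | rnorm x <= 1]].

(* Meaningful when A is a bijection from its domain onto H. *)
Definition op_inv A : H -> H :=
  fun y => xget 0 [set x | dom A x /\ A x = y].

Definition in_BH A : Prop := dom A = setT /\ is_BH A.

Definition rho A B : set R[i] :=
  [set l | set_bij (dom (pencil l A B)) setT (pencil l A B) /\
           is_BH (op_inv (pencil l A B))].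

Definition sigma A B : set R[i] := ~` rho A B.

(* On sigma A B the inverse in the second set has no meaning, but the first
   set contains these points anyway. *)
Definition pseudospectrum (n : nat) (e : R) A B : set R[i] :=
  sigma A B `|`
  [set l | opnorm (iter (2 ^ n) (op_inv (pencil l A B))) `^ ((2 ^ n)%:R^-1)
           >= e^-1].

End operations.

Definition disc (R : realType) (r : R) : set R[i] := [set l | rnorm l <= r].

Definition sumset (R : realType) (X Y : set R[i]) : set R[i] :=
  [set x + y | x in X & y in Y].

Definition affine_image (R : realType) (a b : R[i]) (X : set R[i]) : set R[i] :=
  [set a + b * z | z in X].

(* Main.v *)
Require Import Defs.
From mathcomp Require Import all_boot all_order all_algebra.
From mathcomp Require Import complex.
From mathcomp Require Import all_classical all_reals all_analysis.
From mathcomp Require Import lra.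

(** Membership of l in a pseudospectrum depends only on the single operator
    P = l B - A: either P is not boundedly invertible, or its inverse T
    satisfies |T^(2^n)|^(1/2^n) >= 1/e.  Such a P is called near singular below.
    The first three claims concern one operator at different levels; the others
    compare two operators with the same domain.

    Monotonicity in n ([near_singularS]) is submultiplicativity of the operator
    norm: |T^(2k)| <= |T^k|^2 with k = 2^n.  Monotonicity in e is immediate, and
    the intersection over all e > 0 leaves only the operators without a bounded
    inverse, because |T^(2^n)|^(1/2^n) is a finite number
    ([near_singular_all]).

    Replacing (A, B) by (a A, a B) multiplies the pencil by a, and

      l B - (b A + a B) = b (((l - a) / b) B - A),

    so that both scaling claims reduce to [near_singular_scale]: if P = a Q then
    T_P = T_Q (a^-1 .), the powers satisfy T_P^k = a^-k T_Q^k by linearity, and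
    the 2^n-th root of the norm is divided by |a|.

    For the enlargement by a disc, (l + m) B - A = (l B - A) + m B is a bounded
    perturbation of size at most d |B|.  By contraposition it suffices that a
    perturbation E of an invertible Q with |E| |T_Q| < 1 remains invertible
    ([invertible_perturb]), with

      |T_P| <= |T_Q| / (1 - |E| |T_Q|);

    for |T_Q| < 1 / (e + d |B|) the right-hand side is less than 1 / e.
    Surjectivity of Q + E comes from a fixed point of z |-> y - E (T_Q z),
    which exists because the space is complete ([contraction_fixpoint]); the
    rest follows from a lower bound for |(Q + E) x|. *)

Set Implicit Arguments.
Unset Strict Implicit.
Unset Printing Implicit Defensive.
Import Order.TTheory GRing.Theory Num.Theory.
Import numFieldNormedType.Exports.

Local Open Scope classical_set_scope.
Local Open Scope ring_scope.
Local Open Scope complex_scope.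

(** * Norms with complex values, read as real numbers *)

Section real_valued_norm.
Context {R : realType}.

Lemma rnormE (V : normedZmodType R[i]) (x : V) : (rnorm x)%:C = `|x|.
Proof. by rewrite /rnorm RRe_real. Qed.

Lemma rnorm_ge0 (V : normedZmodType R[i]) (x : V) : 0 <= rnorm x.
Proof. by rewrite -ler0c rnormE. Qed.

Lemma rnorm_eq0 (V : normedZmodType R[i]) (x : V) : (rnorm x == 0) = (x == 0).
Proof. by rewrite -(inj_eq (@complexI R)) rnormE normr_eq0. Qed.

Lemma rnorm0 (V : normedZmodType R[i]) : rnorm (0 : V) = 0.
Proof. by apply/eqP; rewrite rnorm_eq0. Qed.

Lemma rnormN (V : normedZmodType R[i]) (x : V) : rnorm (- x) = rnorm x.
Proof. by rewrite /rnorm normrN. Qed.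

Lemma ler_rnormD (V : normedZmodType R[i]) (x y : V) :
  rnorm (x + y) <= rnorm x + rnorm y.
Proof. by rewrite -lecR rmorphD/= !rnormE ler_normD. Qed.

Lemma rdistC (V : normedZmodType R[i]) (x y : V) :
  rnorm (x - y) = rnorm (y - x).
Proof. by rewrite /rnorm distrC. Qed.

Lemma rnormZ (V : normedModType R[i]) (a : R[i]) (x : V) :
  rnorm (a *: x) = rnorm a * rnorm x.
Proof. by apply: (@complexI R); rewrite rmorphM/= !rnormE normrZ. Qed.

Lemma rnormX (a : R[i]) k : rnorm (a ^+ k) = rnorm a ^+ k.
Proof. by apply: (@complexI R); rewrite rmorphXn/= !rnormE normrX. Qed.

Lemma rnormV (a : R[i]) : rnorm a^-1 = (rnorm a)^-1.
Proof. by apply: (@complexI R); rewrite fmorphV/= !rnormE normfV. Qed.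

Lemma rnorm_gt0 (V : normedZmodType R[i]) (x : V) : (0 < rnorm x) = (x != 0).
Proof. by rewrite lt_def rnorm_ge0 andbT rnorm_eq0. Qed.

(** The topology of a normed space over R[i] is tested on positive complex
    numbers; these are real, so positive real radii suffice. *)
Lemma rnorm_cvgP (V : normedModType R[i]) (u : nat -> V) (p : V) :
  u @ \oo --> p <->
  forall e : R, 0 < e -> \forall k \near \oo, rnorm (p - u k) < e.
Proof.
split=> [/cvgrPdist_lt up e e0|up].
  have /up : 0 < e%:C by rewrite ltcR.
  by apply: filterS => k; rewrite -rnormE ltcR.
apply/cvgrPdist_lt => e e0.
have eE : (complex.Re e)%:C = e by rewrite RRe_real// gtr0_real.
have : 0 < complex.Re e by rewrite -ltcR eE.
by move/up; apply: filterS => k; rewrite -rnormE -eE ltcR.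
Qed.

Lemma rnorm_cauchy_cvg (V : completeNormedModType R[i]) (u : nat -> V) :
  (forall e : R, 0 < e -> exists k, forall m, rnorm (u k - u (m + k)%N) < e) ->
  exists p : V, u @ \oo --> p.
Proof.
move=> uC; exists (lim (u @ \oo)).
apply: cauchy_cvg; apply: cauchy_exP => e e0.
have eE : (complex.Re e)%:C = e by rewrite RRe_real// gtr0_real.
have : 0 < complex.Re e by rewrite -ltcR eE.
move=> /uC[k kP]; exists (u k), k => // m /= km.
by rewrite -ball_normE /= -eE -rnormE ltcR -(subnK km).
Qed.

(** The iterates u k of f from 0 form a Cauchy sequence: u k stays within
    q^k c of all later iterates, with c = |u 0 - u 1| / (1 - q). *)
Lemma contraction_fixpoint (V : completeNormedModType R[i]) (f : V -> V)
    (q : R) :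
  q < 1 -> (forall x y, rnorm (f x - f y) <= q * rnorm (x - y)) ->
  exists p, p = f p.
Proof.
move=> q1' fq'.
(* The powers of q are used as bounds below, so replace q by max (q, 0). *)
wlog q0 : q q1' fq' / 0 <= q.
  move=> /(_ (Num.max q 0)); apply.
  - by rewrite gt_max q1' ltr01.
  - move=> x y; apply: (le_trans (fq' x y)).
    by rewrite ler_wpM2r ?rnorm_ge0// le_max lexx.
  - by rewrite le_max lexx orbT.
pose u k := iter k f 0.
pose c := rnorm (u 0%N - u 1%N) / (1 - q).
have q1 : 0 < 1 - q by rewrite subr_gt0.
have c0 : 0 <= c by rewrite divr_ge0 ?rnorm_ge0// ltW.
have dist0 m : rnorm (u 0%N - u m) <= c.
  elim: m => [|m IH]; first by rewrite subrr rnorm0.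
  have -> : u 0%N - u m.+1 = (u 0%N - u 1%N) + (f (u 0%N) - f (u m)).
    by rewrite /u /= addrA subrK.
  apply: (le_trans (ler_rnormD _ _)).
  (* c is the sum of the geometric series with terms |u 0 - u 1| q^i. *)
  have -> : c = rnorm (u 0%N - u 1%N) + q * c.
    apply/eqP; rewrite -subr_eq -{1}[c]mul1r -mulrBl mulrC.
    by rewrite /c divfK// gt_eqF.
  by rewrite lerD2l (le_trans (fq' _ _))// ler_wpM2l.
have distk k m : rnorm (u k - u (m + k)%N) <= q ^+ k * c.
  elim: k => [|k IH]; first by rewrite addn0 expr0 mul1r.
  rewrite addnS /u /= exprS -mulrA (le_trans (fq' _ _))//.
  exact: ler_wpM2l.
have [|p up] := @rnorm_cauchy_cvg V u.
  move=> e e0.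
  have /cvgrPdist_lt/(_ _ e0)[k _ /(_ k (leqnn k))/=] :
      geometric c q @ \oo --> (0 : R).
    by apply: cvg_geometric; rewrite ger0_norm.
  rewrite sub0r normrN /= (ger0_norm (mulr_ge0 c0 (exprn_ge0 k q0))) => qk.
  by exists k => m; rewrite (le_lt_trans (distk k m))// mulrC.
exists p; apply/eqP; rewrite -subr_eq0 -rnorm_eq0 eq_le rnorm_ge0 andbT.
(* The gap |p - f p| is at most |p - u (k + 1)| + q |p - u k|, which becomes
   smaller than the gap itself once both distances are below half of it. *)
rewrite leNgt; apply/negP => d0.
have d2 : 0 < rnorm (p - f p) / 2 by lra.
have [k _ kP] := (rnorm_cvgP u p).1 up _ d2.
have /= uk := kP k (leqnn k).
have /= uk1 := kP k.+1 (leqnSn k).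
have := ler_rnormD (p - f (u k)) (f (u k) - f p).
rewrite addrA subrK => h.
have := fq' (u k) p; rewrite [rnorm (u k - p)]rdistC => h'.
have : q * rnorm (p - u k) <= rnorm (p - u k).
  by rewrite ler_piMl ?rnorm_ge0// ltW.
by rewrite -/(u k.+1) in h; lra.
Qed.

End real_valued_norm.

(** * Operator norms of bounded operators *)

Section bounded_operators.
Context {R : realType} {H : hilbertType R}.
Implicit Types f g : H -> H.

Let normset f := [set rnorm (f x) | x in [set x | rnorm x <= 1]].

Lemma opnorm_le f (M : R) : 0 <= M ->
  (forall x, rnorm (f x) <= M * rnorm x) -> opnorm f <= M.
Proof.
move=> M0 fM; apply: ge_sup.
  by exists (rnorm (f 0)), 0 => //=; rewrite rnorm0.
by move=> _ [x /= x1 <-]; rewrite (le_trans (fM x))// ler_piMr.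
Qed.

Lemma normset_has_ubound f : is_BH f -> has_ubound (normset f).
Proof.
move=> [_ [M fM]]; exists (Num.max M 0) => _ [x /= x1 <-].
apply: (le_trans (fM x)); apply: (@le_trans _ _ (Num.max M 0 * rnorm x)).
  by rewrite ler_wpM2r ?rnorm_ge0// le_max lexx.
by rewrite ler_piMr// le_max lexx orbT.
Qed.

Lemma opnorm_ge0 f : is_BH f -> 0 <= opnorm f.
Proof.
move=> fB; apply: (le_trans (rnorm_ge0 (f 0))).
apply: ub_le_sup; first exact: normset_has_ubound.
by exists 0 => //=; rewrite rnorm0.
Qed.

Lemma is_BHZ f a x : is_BH f -> f (a *: x) = a *: f x.
Proof.
move=> [fl _].
have f0 : f 0 = 0.
  have := fl 1 0 0; rewrite !scale1r addr0 => /eqP.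
  by rewrite -subr_eq0 opprD addrA subrr sub0r oppr_eq0 => /eqP.
by have := fl a x 0; rewrite !addr0 f0 addr0.
Qed.

(** The supremum over the unit ball controls every vector by homogeneity:
    apply it to x / |x|. *)
Lemma opnorm_bound f x : is_BH f -> rnorm (f x) <= opnorm f * rnorm x.
Proof.
move=> fB; have [->|x0] := eqVneq x 0.
  by rewrite -[0 : H](scale0r 0) (is_BHZ _ _ fB) !scale0r rnorm0 mulr0.
have nx : 0 < rnorm x by rewrite rnorm_gt0.
rewrite -ler_pdivrMr//.
have : normset f (rnorm (f ((rnorm x)^-1%:C *: x))).
  exists ((rnorm x)^-1%:C *: x) => //=.
  rewrite fmorphV/= rnormE rnormZ rnormV {1}/rnorm normr_id -/(rnorm x).
  by rewrite mulVf ?gt_eqF.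
rewrite (is_BHZ _ _ fB) rnormZ fmorphV/= rnormE rnormV.
rewrite {1}/rnorm normr_id -/(rnorm x) mulrC.
by apply: ub_le_sup; first exact: normset_has_ubound.
Qed.

Lemma is_BH_comp f g : is_BH f -> is_BH g -> is_BH (f \o g).
Proof.
move=> fB gB; split.
  by move=> a x y /=; rewrite gB.1 fB.1.
exists (opnorm f * opnorm g) => x /=.
apply: (le_trans (opnorm_bound _ fB)); rewrite -mulrA.
by rewrite ler_wpM2l ?opnorm_ge0// opnorm_bound.
Qed.

Lemma opnorm_comp f g : is_BH f -> is_BH g ->
  opnorm (f \o g) <= opnorm f * opnorm g.
Proof.
move=> fB gB; apply: opnorm_le; first by rewrite mulr_ge0 ?opnorm_ge0.
move=> x /=; apply: (le_trans (opnorm_bound _ fB)); rewrite -mulrA.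
by rewrite ler_wpM2l ?opnorm_ge0// opnorm_bound.
Qed.

Lemma is_BH_iter f k : is_BH f -> is_BH (iter k f).
Proof.
move=> fB; elim: k => [|k IH]; last exact: (is_BH_comp fB IH).
by split=> //; exists 1 => x; rewrite mul1r.
Qed.

(** Precomposition with a homothety is how scaling an operator acts on its
    inverse; see [op_inv_scale]. *)
Lemma is_BH_dilate f c : is_BH f -> is_BH (fun x => f (c *: x)).
Proof.
move=> fB; split.
  by move=> a x y /=; rewrite !(is_BHZ _ _ fB) fB.1 scalerDr !scalerA mulrC.
exists (opnorm f * rnorm c) => x; rewrite -mulrA -rnormZ.
exact: opnorm_bound.
Qed.

Lemma iter_dilate f c k x : is_BH f ->
  iter k (fun y => f (c *: y)) x = iter k f (c ^+ k *: x).
Proof.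
move=> fB; elim: k => [|k IH] /=; first by rewrite expr0 scale1r.
by rewrite IH exprS -scalerA [in RHS](is_BHZ c _ (is_BH_iter k fB)).
Qed.

Lemma opnorm_dilate_le f c : is_BH f ->
  opnorm (fun x => f (c *: x)) <= rnorm c * opnorm f.
Proof.
move=> fB; apply: opnorm_le; first by rewrite mulr_ge0 ?rnorm_ge0 ?opnorm_ge0.
by move=> x; rewrite mulrAC -rnormZ mulrC opnorm_bound.
Qed.

(** The reverse inequality is [opnorm_dilate_le] for the factor c^-1. *)
Lemma opnorm_dilate f c : c != 0 -> is_BH f ->
  opnorm (fun x => f (c *: x)) = rnorm c * opnorm f.
Proof.
move=> c0 fB; apply/eqP; rewrite eq_le opnorm_dilate_le//=.
rewrite mulrC -ler_pdivlMr ?rnorm_gt0// mulrC -rnormV.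
have := opnorm_dilate_le c^-1 (is_BH_dilate c fB).
by under [X in opnorm X]eq_fun do rewrite scalerA divff// scale1r.
Qed.

(** The terms, along the powers of 2, of the sequence |f^k|^(1/k) that tends to
    the spectral radius of f. *)
Definition power_root n f : R := opnorm (iter (2 ^ n) f) `^ ((2 ^ n)%:R^-1).

Lemma power_root0 f : is_BH f -> power_root 0 f = opnorm f.
Proof. by move=> fB; rewrite /power_root expn0 invr1 powRr1// opnorm_ge0. Qed.

(** Submultiplicativity gives |f^(2k)| <= |f^k|^2 with k = 2^n; the root of
    order 2k then turns the square into a root of order k. *)
Lemma power_rootS n f : is_BH f -> power_root n.+1 f <= power_root n f.
Proof.
move=> fB; have fn := is_BH_iter (2 ^ n) fB.
set a := opnorm (iter (2 ^ n) f).
have a0 : 0 <= a by exact: opnorm_ge0.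
apply: (@le_trans _ _ ((a ^+ 2) `^ (2 ^ n.+1)%:R^-1)).
  apply: ge0_ler_powR; rewrite ?nnegrE ?exprn_ge0 ?invr_ge0//.
    exact/opnorm_ge0/is_BH_iter.
  rewrite expr2; apply: le_trans (opnorm_comp fn fn).
  rewrite expnS mul2n -addnn le_eqVlt; apply/orP; left; apply/eqP.
  by congr opnorm; apply/funext => x; rewrite /= iterD.
by rewrite -powR_mulrn// -powRrM expnS natrM invfM mulrA divff// mul1r lexx.
Qed.

(** By linearity the k-th iterate of x |-> f (c x) is x |-> f^k (c^k x); its
    norm carries |c|^k, and the k-th root restores |c|. *)
Lemma power_root_dilate n f c : c != 0 -> is_BH f ->
  power_root n (fun x => f (c *: x)) = rnorm c * power_root n f.
Proof.
move=> c0 fB; rewrite /power_root.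
have -> : iter (2 ^ n) (fun x => f (c *: x)) =
    (fun x => iter (2 ^ n) f (c ^+ (2 ^ n) *: x)).
  by apply/funext => x; exact: iter_dilate.
rewrite opnorm_dilate ?expf_neq0//; last exact: is_BH_iter.
rewrite powRM ?rnorm_ge0 ?opnorm_ge0//; last exact: is_BH_iter.
by rewrite rnormX -powR_mulrn ?rnorm_ge0// -powRrM divff ?powRr1 ?rnorm_ge0.
Qed.

End bounded_operators.

(** * Bounded inverses under perturbation and scaling *)

Section invertible_operators.
Context {R : realType} {H : hilbertType R}.
Implicit Types P Q : linop H.

Definition invertible P : Prop :=
  set_bij (dom P) setT P /\ is_BH (op_inv P).

(** The membership condition of the pseudospectra as a property of one operator,
    so that pencils of different pairs (A, B) can be compared. *)
Definition near_singular n (e : R) P : Prop :=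
  ~ invertible P \/ e^-1 <= power_root n (op_inv P).

Lemma pseudospectrumE n e (A B : linop H) l :
  pseudospectrum n e A B l = near_singular n e (pencil l A B).
Proof. by []. Qed.

Lemma not_near_singular n e P :
  ~ near_singular n e P <-> invertible P /\ power_root n (op_inv P) < e^-1.
Proof.
split=> [|[Pi Pe] [//|]]; last by rewrite leNgt Pe.
move=> /not_orP[/contrapT Pi /negP]; by rewrite -ltNge.
Qed.

Lemma op_inv_spec P y : set_surj (dom P) setT P ->
  dom P (op_inv P y) /\ P (op_inv P y) = y.
Proof.
move=> /(_ y I)[x Px Pxy].
exact: (@xgetI _ 0 [set x | dom P x /\ P x = y] x).
Qed.

Lemma op_invK P x : set_bij (dom P) setT P -> dom P x -> op_inv P (P x) = x.
Proof.
move=> [_ Pinj Psurj] Px; have [Pd Pe] := op_inv_spec (P x) Psurj.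
by apply: Pinj; rewrite ?inE.
Qed.

Lemma op_inv_linear P : set_bij (dom P) setT P -> linear (op_inv P).
Proof.
move=> Pb a x y; have [_ _ Ps] := Pb.
have [dx xE] := op_inv_spec x Ps; have [dy yE] := op_inv_spec y Ps.
rewrite -[in LHS]xE -[in LHS]yE -op_linear// op_invK//.
exact: dom_linear.
Qed.

(** With T the inverse of Q and q = |E| |T|, the operator E T has norm at most
    q < 1 and P = (1 + E T) Q.  Hence |P x| >= (1 - q) |Q x|, which gives
    injectivity and the bound on the inverse; surjectivity amounts to solving
    z + E (T z) = y, a fixed-point problem for a contraction. *)
Lemma invertible_perturb P Q (E : H -> H) :
  dom P = dom Q -> (forall x, dom P x -> P x = Q x + E x) ->
  invertible Q -> is_BH E -> opnorm E * opnorm (op_inv Q) < 1 ->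
  invertible P /\
  opnorm (op_inv P) <= opnorm (op_inv Q) / (1 - opnorm E * opnorm (op_inv Q)).
Proof.
move=> dPQ PE [Qb TB] EB; set T := op_inv Q; set q := _ * _ => q1.
have {}q1 : 0 < 1 - q by rewrite subr_gt0.
have [_ _ Qs] := Qb; have Tl : linear T := TB.1.
have ET x : rnorm (E (T x)) <= q * rnorm x.
  apply: (le_trans (opnorm_bound _ EB)); rewrite -mulrA.
  by rewrite ler_wpM2l ?opnorm_ge0// opnorm_bound.
have M0 : 0 <= opnorm T / (1 - q) by rewrite divr_ge0 ?opnorm_ge0// ltW.
have Pbelow x : dom P x -> rnorm x <= opnorm T / (1 - q) * rnorm (P x).
  move=> Px; have Qx : dom Q x by rewrite -dPQ.
  have Tx : T (Q x) = x by exact: op_invK.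
  have Qle : rnorm (Q x) * (1 - q) <= rnorm (P x).
    have := ler_rnormD (P x) (- E x).
    rewrite PE// addrK rnormN => h.
    by have := ET (Q x); rewrite Tx; lra.
  rewrite -{1}Tx; apply: (le_trans (opnorm_bound _ TB)).
  by rewrite -mulrA ler_wpM2l ?opnorm_ge0// mulrC ler_pdivlMr.
have Ps : set_surj (dom P) setT P.
  move=> y _.
  have [||z zE] := @contraction_fixpoint R H (fun z => y - E (T z)) q.
  - by rewrite -subr_gt0.
  - move=> z z'.
    have -> : y - E (T z) - (y - E (T z')) = E (T (z' - z)).
      have -> : z' - z = -1 *: z + z' by rewrite scaleN1r addrC.
      by rewrite Tl EB.1 scaleN1r opprB [LHS]addrC addrA subrK addrC.
    by rewrite (rdistC z z'); exact: ET.
  have [Tz QTz] := op_inv_spec z Qs; exists (T z); first by rewrite dPQ.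
  by rewrite PE ?dPQ// QTz {1}zE subrK.
have Pb : set_bij (dom P) setT P.
  split=> // x x' /set_mem Px /set_mem Px' Pxx'.
  have dx : dom P (-1 *: x' + x) by exact: dom_linear.
  have := Pbelow _ dx; rewrite op_linear// Pxx' !scaleN1r addNr rnorm0 mulr0.
  rewrite addrC => h; apply/eqP; rewrite -subr_eq0 -rnorm_eq0.
  by rewrite eq_le h rnorm_ge0.
have PTB y : rnorm (op_inv P y) <= opnorm T / (1 - q) * rnorm y.
  have [Py PyE] := op_inv_spec y Ps.
  by have := Pbelow _ Py; rewrite PyE.
split; last exact: opnorm_le.
by split=> //; split; [exact: op_inv_linear|exists (opnorm T / (1 - q))].
Qed.

(** Contrapositive of [invertible_perturb]: from |T| < 1 / (e + d) it follows
    that |T| / (1 - d |T|) < 1 / e. *)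
Lemma near_singular_perturb P Q (E : H -> H) (e d : R) :
  dom P = dom Q -> (forall x, dom P x -> P x = Q x + E x) ->
  0 < e -> is_BH E -> opnorm E <= d ->
  near_singular 0 e P -> near_singular 0 (e + d) Q.
Proof.
move=> dPQ PE e0 EB Ed; apply: contraPP => /not_near_singular[Qi].
have TB := Qi.2; rewrite power_root0// => Te.
have d0 : 0 <= d by rewrite (le_trans (opnorm_ge0 EB)).
have ed : 0 < e + d by lra.
have T0 := opnorm_ge0 TB; set t := opnorm _ in Te T0.
have Te' : t * (e + d) < 1 by rewrite -ltr_pdivlMr// mul1r.
(* With this bound the remaining inequalities are linear in the products t * e,
   t * d and opnorm E * t. *)
have q1 : opnorm E * t <= d * t by rewrite ler_wpM2r.
have te : 0 <= t * e by rewrite mulr_ge0// ltW.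
have [|Pi Pe] := invertible_perturb dPQ PE Qi EB; first by rewrite -/t; lra.
apply/not_near_singular; split=> //; rewrite power_root0; last exact: Pi.2.
apply: (le_lt_trans Pe); rewrite -/t.
rewrite ltr_pdivrMr; last by lra.
by rewrite -ltr_pdivrMl ?invr_gt0// invrK; lra.
Qed.

(** The solution sets of P x = y and Q x = a^-1 y coincide, so the chosen
    solutions agree even where no solution exists. *)
Lemma op_inv_scale P Q (a : R[i]) : a != 0 -> dom P = dom Q ->
  (forall x, dom P x -> P x = a *: Q x) ->
  op_inv P = fun y => op_inv Q (a^-1 *: y).
Proof.
move=> a0 dPQ PQ; apply/funext => y; congr (xget 0 _).
apply/seteqP; split=> x /=; rewrite -dPQ => -[Px].
  by rewrite PQ// => <-; rewrite scalerA mulVf// scale1r.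
by move=> QE; rewrite PQ// QE scalerA divff// scale1r.
Qed.

Lemma invertible_scale P Q (a : R[i]) : a != 0 -> dom P = dom Q ->
  (forall x, dom P x -> P x = a *: Q x) -> invertible Q -> invertible P.
Proof.
move=> a0 dPQ PQ [[Qf Qi Qs] QB]; split; last first.
  by rewrite (op_inv_scale a0 dPQ PQ); exact: is_BH_dilate.
split=> //.
  move=> x y Px Py; rewrite !PQ; [|exact: set_mem..] => /(scalerI a0).
  by apply: Qi; rewrite -dPQ.
move=> y _; have [x Qx QxE] := Qs (a^-1 *: y) I.
exists x; first by rewrite dPQ.
by rewrite PQ ?dPQ// QxE scalerA divff// scale1r.
Qed.

Lemma near_singular_scale_sub n e P Q (a : R[i]) : a != 0 -> dom P = dom Q ->
  (forall x, dom P x -> P x = a *: Q x) ->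
  near_singular n e P -> near_singular n (e / rnorm a) Q.
Proof.
move=> a0 dPQ PQ; apply: contraPP => /not_near_singular[Qi Qe].
apply/not_near_singular; split; first exact: (invertible_scale a0 dPQ PQ).
rewrite (op_inv_scale a0 dPQ PQ) power_root_dilate ?invr_eq0//;
  last exact: Qi.2.
by rewrite rnormV mulrC ltr_pdivrMr ?rnorm_gt0// -[rnorm a]invrK -invfM.
Qed.

(** One inclusion suffices: the other is the same one for Q = a^-1 P. *)
Lemma near_singular_scale n e P Q (a : R[i]) : a != 0 -> dom P = dom Q ->
  (forall x, dom P x -> P x = a *: Q x) ->
  near_singular n e P <-> near_singular n (e / rnorm a) Q.
Proof.
move=> a0 dPQ PQ; split; first exact: near_singular_scale_sub.
have QP x : dom Q x -> Q x = a^-1 *: P x.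
  by rewrite -dPQ => Px; rewrite PQ// scalerA mulVf// scale1r.
have ai0 : a^-1 != 0 by rewrite invr_eq0.
move=> /(near_singular_scale_sub ai0 (esym dPQ) QP).
by rewrite rnormV invrK divfK// rnorm_eq0.
Qed.

Lemma near_singularS n e P : near_singular n.+1 e P -> near_singular n e P.
Proof.
move=> [Pi|Pe]; first by left.
have [Pi|] := pselect (invertible P); last by left.
by right; rewrite (le_trans Pe)// power_rootS//; exact: Pi.2.
Qed.

Lemma near_singular0 n e P : near_singular n e P -> near_singular 0 e P.
Proof. by elim: n => // n IH /near_singularS. Qed.

Lemma near_singular_le n e1 e2 P : 0 < e1 -> e1 <= e2 ->
  near_singular n e1 P -> near_singular n e2 P.
Proof.
move=> e10 e12 [Pi|Pe]; first by left.
by right; rewrite (le_trans _ Pe)// lef_pV2// posrE// (lt_le_trans e10).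
Qed.

(** A boundedly invertible P fails the condition for e = 1 / (t + 1), where t is
    the corresponding root of the norm. *)
Lemma near_singular_all n P :
  ~ invertible P <-> forall e, 0 < e -> near_singular n e P.
Proof.
split=> [Pi e _|]; first by left.
move=> Pe Pi; set t := power_root n (op_inv P).
have t0 : 0 <= t by exact: powR_ge0.
have t1 : 0 < t + 1 by lra.
have t2 : 0 < (t + 1)^-1 by rewrite invr_gt0.
by have [//|] := Pe _ t2; rewrite invrK -/t; lra.
Qed.

End invertible_operators.

(** * Properties of the pseudospectra *)

Theorem theorem2p4 (R : realType) (H : hilbertType R) (A B : linop H)
    (hA : closed_op A) (hB : closed_op B) (n : nat) (e : R) (he : 0 < e) :
  (pseudospectrum n.+1 e A B `<=` pseudospectrum n e A B) /\
  (forall e1 e2 : R, 0 < e1 -> e1 <= e2 ->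
     pseudospectrum n e1 A B `<=` pseudospectrum n e2 A B) /\
  (sigma A B =
     \bigcap_(e' in [set e' : R | 0 < e']) pseudospectrum n e' A B) /\
  (in_BH B -> forall d : R, 0 < d ->
     sumset (pseudospectrum n e A B) (disc d) `<=`
       sumset (pseudospectrum 0 e A B) (disc d) /\
     sumset (pseudospectrum 0 e A B) (disc d) `<=`
       pseudospectrum 0 (e + d * opnorm B) A B) /\
  (forall a : R[i], a != 0 ->
     pseudospectrum n e (scale_op a A) (scale_op a B) =
     pseudospectrum n (e / rnorm a) A B) /\
  (forall a b : R[i], b != 0 ->
     pseudospectrum n e (add_op (scale_op b A) (scale_op a B)) B =
     affine_image a b (pseudospectrum n (e / rnorm b) A B)).
Proof.
split; first by move=> l; rewrite !pseudospectrumE; exact: near_singularS.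
split.
  by move=> e1 e2 e10 e12 l; rewrite !pseudospectrumE; exact: near_singular_le.
split.
  apply/seteqP; split=> l; first by move=> ls e' _; left.
  by move=> le; apply/(near_singular_all n) => e' /le.
split.
  move=> [BT BB] d d0; split.
    move=> _ [l ls [m md <-]]; exists l; last by exists m.
    by move: ls; rewrite !pseudospectrumE; exact: near_singular0.
  move=> _ [l ls [m md <-]]; rewrite pseudospectrumE.
  (* Go from the pencil at l + m back to the one at l, by subtracting m B. *)
  apply: (@near_singular_perturb _ _ (pencil l A B) _ (fun x => B (- m *: x)))
    ls => //.
  - move=> x /= _; rewrite (is_BHZ _ _ BB) scalerDl !scaleNr.
    by rewrite [RHS]addrAC addrK.
  - exact: is_BH_dilate.
  - apply: (le_trans (opnorm_dilate_le _ BB)).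
    by rewrite rnormN ler_wpM2r ?opnorm_ge0.
split.
  move=> a a0; apply/eq_set => l; apply/propext.
  change (near_singular n e (pencil l (scale_op a A) (scale_op a B)) <->
    near_singular n (e / rnorm a) (pencil l A B)).
  apply: near_singular_scale => //= x _.
  by rewrite scalerDr !scalerA mulrC mulN1r mulrN1.
move=> a b b0.
have key l : pseudospectrum n e (add_op (scale_op b A) (scale_op a B)) B l <->
    pseudospectrum n (e / rnorm b) A B ((l - a) / b).
  rewrite !pseudospectrumE; apply: near_singular_scale => //=.
    by rewrite [LHS]setIC -setIA setIid setIC.
  move=> x _; rewrite !scalerDr !scalerA (mulrC b ((l - a) / b)) divfK//.
  by rewrite mulrN1 !mulN1r !scaleNr scalerBl addrA addrAC.
apply/seteqP; split=> l.
  move=> /key lb; exists ((l - a) / b) => //.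
  by rewrite mulrC divfK// addrC subrK.
move=> [z zb <-]; apply/key.
by rewrite [a + _]addrC addrK mulrAC divff// mul1r.
Qed.
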